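(* Let $n\ge3$, $\alpha\in(0,n)$, $p,q>0$ with $pq>1$, and let $u,v$ be positive bounded solutions on $\mathbb{R}^n$ of $$u(x)=\int_{\mathbb{R}^n}\frac{v^q(y)\,dy}{|x-y|^{n-\alpha}},\qquad v(x)=\int_{\mathbb{R}^n}\frac{u^p(y)\,dy}{|x-y|^{n-\alpha}}.$$ (1) Let $\theta_1<\frac{\alpha(q+1)}{pq-1}$ and $\theta_2<\frac{\alpha(p+1)}{pq-1}$. Then there is no $C>0$ such that $u(x)\ge C(1+|x|)^{-\theta_1}$ for all sufficiently large $|x|$, and there is no $C>0$ such that $v(x)\ge C(1+|x|)^{-\theta_2}$ for all sufficiently large $|x|$. (2) Suppose moreover $(u,v)\notin L^{r_0}(\mathbb{R}^n)\times L^{s_0}(\mathbb{R}^n)$, where $r_0=\frac{n(pq-1)}{\alpha(q+1)}$, $s_0=\frac{n(pq-1)}{\alpha(p+1)}$. Let $\theta_3>\frac{\alpha(q+1)}{pq-1}$ and $\theta_4>\frac{\alpha(p+1)}{pq-1}$. Then there is no $C>0$ such that $u(x)\le C(1+|x|)^{-\theta_3}$ for all sufficiently large $|x|$, and there is no $C>0$ such that $v(x)\le C(1+|x|)^{-\theta_4}$ for all sufficiently large $|x|$.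
   Context: Positive solutions are positive measurable functions satisfying both integral identities (finite) at every point. *)

(* Defs.v *)
From HB Require Import structures.
From mathcomp Require Import all_boot all_order all_algebra.
From mathcomp Require Import all_classical all_reals all_analysis.
Set Implicit Arguments. Unset Strict Implicit. Unset Printing Implicit Defensive.
Import Order.TTheory GRing.Theory Num.Theory.
Import numFieldNormedType.Exports.
Local Open Scope classical_set_scope.
Local Open Scope ring_scope.

Section RnDefs.
Variable R : realType.

Definition enorm (n : nat) (x : 'rV[R]_n) : R :=
  Num.sqrt (\sum_(i < n) (x ord0 i) ^+ 2).

Definition row_cons (n : nat) (t : R) (w : 'rV[R]_n) : 'rV[R]_n.+1 :=
  \row_(i < n.+1) match unlift ord0 i with None => t | Some j => w ord0 j end.

(* Lebesgue integral over R^n of a (nonnegative) function, written as the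
   iterated integral over the n coordinates (equal to the integral w.r.t.
   n-dimensional Lebesgue measure for nonnegative Borel functions, by Tonelli). *)
Fixpoint Rn_integral (n : nat) : ('rV[R]_n -> \bar R) -> \bar R :=
  match n with
  | 0 => fun f => f 0
  | n'.+1 => fun f =>
      (\int[@lebesgue_measure R]_t Rn_integral (fun w => f (row_cons t w)))%E
  end.

Definition Rn_measurable (n : nat) (f : 'rV[R]_n -> R) : Prop :=
  forall B : set R, measurable B -> <<s (@open 'rV[R]_n) >> (f @^-1` B).

Definition riesz_pot (n : nat) (alpha : R) (g : 'rV[R]_n -> R) (x : 'rV[R]_n)
  : \bar R :=
  Rn_integral (fun y => (g y / (enorm (x - y)) `^ (n%:R - alpha))%:E).

Definition in_Lp (n : nat) (r : R) (f : 'rV[R]_n -> R) : Prop :=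
  Rn_measurable f /\ (Rn_integral (fun x => ((`|f x|) `^ r)%:E) < +oo)%E.

Definition pos_bounded_solution (n : nat) (alpha p q : R)
  (u v : 'rV[R]_n -> R) : Prop :=
  Rn_measurable u /\ Rn_measurable v /\
  (forall x, 0 < u x) /\ (forall x, 0 < v x) /\
  (exists M : R, forall x, u x <= M /\ v x <= M) /\
  (forall x, (u x)%:E = riesz_pot alpha (fun y => v y `^ q) x) /\
  (forall x, (v x)%:E = riesz_pot alpha (fun y => u y `^ p) x).

End RnDefs.

(* Main.v *)
(** Part (1): a lower bound [u >= C (1+|x|)^-theta] near infinity, integrated
    over the cube [[2|x|, 3|x|]^n], gives [v >= C' (1+|x|)^-(p theta - alpha)];
    doing this twice multiplies the gap between [theta] and the critical rate
    [a = alpha (q+1) / (pq-1)] by [pq > 1], so that the rate eventually becomes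
    negative, against boundedness.

    Part (2): let [u <= C (1+|x|)^-theta3] with [theta3 > a], and let [b] be the
    critical rate of [v]. Any potential is at least [c (1+|x|)^-(n-alpha)]; if
    [n - alpha <= b], then one more potential gives [u >= c (1+|x|)^-a] near
    infinity, a contradiction. Hence [p a = b + alpha < n], and one can lower
    the exponent to some [theta > a] with [p theta < n]. Both the kernel and the
    decaying weight are then dominated by products of functions of a single
    coordinate, so the bounds [u in L^r0] and [v in L^s0] reduce to
    one-dimensional estimates. *)

Require Import Defs.
From HB Require Import structures.
From mathcomp Require Import all_boot all_order all_algebra.
From mathcomp Require Import all_classical all_reals all_analysis.
From mathcomp Require Import measurable_realfun ring lra.
Import Order.TTheory GRing.Theory Num.Theory.
Import numFieldNormedType.Exports.
Local Open Scope classical_set_scope.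
Local Open Scope ring_scope.
Set Implicit Arguments. Unset Strict Implicit. Unset Printing Implicit Defensive.

(** * Integrals of nonnegative functions without measurability *)

(* Sections of the data and their partial integrals are not known to be
   measurable here; [integral] is then the lower integral, a supremum over
   simple functions. *)
Section LowerIntegral.
Context {R : realType}.
Local Notation mu := (@lebesgue_measure R).
Implicit Types f g : R -> \bar R.
Local Open Scope ereal_scope.
Import HBNNSimple.

Lemma integral_le f g : (forall x, 0 <= f x) -> (forall x, f x <= g x) ->
  \int[mu]_x f x <= \int[mu]_x g x.
Proof.
move=> f0 fg; rewrite !ge0_integralTE//; last by move=> x; exact: le_trans (fg x).
by apply: le_ereal_sup => _ [h hf <-]; exists h => // x; exact: le_trans (fg x).
Qed.

Lemma integral_le_nnsfun f (M : \bar R) : (forall x, 0 <= f x) ->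
  (forall h : {nnsfun measurableTypeR R >-> measurableTypeR R}, (forall x, (h x)%:E <= f x) ->
     \int[mu]_x (h x)%:E <= M) ->
  \int[mu]_x f x <= M.
Proof.
move=> f0 H; rewrite ge0_integralTE//; apply: ge_ereal_sup => _ [h hf <-].
by rewrite -integralT_nnsfun; exact: (H h).
Qed.

(** A simple minorant [h] of [f] scales to a minorant [c h] of [c f]; linearity is applied to the
    measurable [h]. *)
Lemma integral_ge_scale f (c : R) : (0 <= c)%R -> (forall x, 0 <= f x) ->
  c%:E * \int[mu]_x f x <= \int[mu]_x (c%:E * f x).
Proof.
rewrite le_eqVlt => /predU1P[<- f0|c0 f0].
  by rewrite mul0e integral_ge0// => x _; rewrite mul0e.
have cV0 : (c^-1 != 0)%R by rewrite invr_eq0 gt_eqF.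
rewrite -lee_pdivlMl//; apply: integral_le_nnsfun => // h hf.
rewrite lee_pdivlMl// -ge0_integralZl_EFin//; last 3 first.
- by move=> x _; rewrite lee_fin.
- exact/measurable_EFinP.
- exact: ltW.
apply: integral_le => x; first by rewrite mule_ge0 ?lee_fin// ltW.
by rewrite lee_wpmul2l// lee_fin ltW.
Qed.

(** A point is Lebesgue-null, so a simple minorant of [f] keeps its integral once cut to 0 at [a],
    where it might exceed [g]. *)
Lemma integral_le_off f g (a : R) : (forall x, 0 <= f x) -> (forall x, 0 <= g x) ->
  (forall x, x != a -> f x <= g x) -> \int[mu]_x f x <= \int[mu]_x g x.
Proof.
move=> f0 g0 fg; apply: integral_le_nnsfun => // h hf.
have mh : measurable_fun [set: measurableTypeR R] (EFin \o h) by exact/measurable_EFinP.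
have h0 x : [set: R] x -> 0 <= (EFin \o h) x by rewrite /= lee_fin.
have -> : \int[mu]_x (h x)%:E = \int[mu]_(x in setT `\` [set a]) (h x)%:E.
  by apply: ge0_negligible_integral => //; exact: lebesgue_measure_set1.
rewrite integral_mkcond; apply: integral_le => x; rewrite patchE; case: ifPn => //=.
  by rewrite lee_fin.
by rewrite inE => -[_ /eqP xa]; exact: le_trans (hf x) (fg _ xa).
Qed.

(** Contrapositive: if the integral of [g] is zero, so is that of [w h] for each simple [h <= f];
    hence [w h], and as [w > 0] also [h], vanishes almost everywhere. *)
Lemma integral_gt0_weight f g (w : R -> R) (a : R) :
  (forall x, 0 <= f x) -> (forall x, 0 <= g x) ->
  (forall x, (0 < w x)%R) -> measurable_fun setT w ->
  (forall x, x != a -> (w x)%:E * f x <= g x) ->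
  0 < \int[mu]_x f x -> 0 < \int[mu]_x g x.
Proof.
move=> f0 g0 w0 mw fg; apply: contraTT; rewrite -!leNgt => G0.
apply: integral_le_nnsfun => // h hf.
have mh : measurable_fun [set: measurableTypeR R] (EFin \o h) by exact/measurable_EFinP.
have mwh : measurable_fun [set: measurableTypeR R] (fun x => (w x * h x)%:E).
  by apply/measurable_EFinP; exact: measurable_funM.
have wh0 : \int[mu]_x (w x * h x)%:E = 0.
  apply/eqP; rewrite eq_le integral_ge0 ?andbT; last first.
    by move=> x _; rewrite lee_fin mulr_ge0// ltW.
  apply: le_trans G0; apply: (@integral_le_off _ _ a) => // x.
    by rewrite lee_fin mulr_ge0// ltW.
  by move=> /fg; apply: le_trans; rewrite EFinM lee_wpmul2l// lee_fin ltW.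
have abs0 : \int[mu]_x `|(w x * h x)%:E| = 0.
  rewrite -wh0; apply: eq_integral => x _.
  by rewrite gee0_abs// lee_fin mulr_ge0// ltW.
have ae0 := (ae_eq_integral_abs mu measurableT mwh).1 abs0.
have -> : \int[mu]_x (h x)%:E = \int[mu]_x cst 0 x.
  apply: ge0_ae_eq_integral => //.
    by move=> x _; rewrite lee_fin.
  apply: filterS ae0 => x /= /(_ I) [] /eqP; rewrite mulf_eq0 gt_eqF//=.
  by move=> /eqP -> _.
by rewrite integral0.
Qed.

End LowerIntegral.

(** * Iterated integrals over R^n *)

Section IteratedIntegral.
Context {R : realType}.
Local Notation mu := (@lebesgue_measure R).
Local Open Scope ereal_scope.

Lemma row_cons0 (n : nat) (t : R) (w : 'rV[R]_n) : row_cons t w ord0 ord0 = t.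
Proof. by rewrite mxE unlift_none. Qed.

Lemma row_consS (n : nat) (t : R) (w : 'rV[R]_n) (j : 'I_n) :
  row_cons t w ord0 (lift ord0 j) = w ord0 j.
Proof. by rewrite mxE liftK. Qed.

Lemma Rn_integral_ge0 (n : nat) (f : 'rV[R]_n -> \bar R) :
  (forall x, 0 <= f x) -> 0 <= Rn_integral f.
Proof.
elim: n f => [|n IHn] f f0 /=; first exact: f0.
by apply: integral_ge0 => t _; exact: IHn.
Qed.

Lemma Rn_integral_le (n : nat) (f g : 'rV[R]_n -> \bar R) :
  (forall x, 0 <= f x) -> (forall x, f x <= g x) ->
  Rn_integral f <= Rn_integral g.
Proof.
elim: n f g => [|n IHn] f g f0 fg /=; first exact: fg.
by apply: integral_le => t; [exact: Rn_integral_ge0|exact: IHn].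
Qed.

Lemma Rn_integral_ge_scale (n : nat) (f : 'rV[R]_n -> \bar R) (c : R) :
  (0 <= c)%R -> (forall x, 0 <= f x) ->
  c%:E * Rn_integral f <= Rn_integral (fun x => c%:E * f x).
Proof.
move=> c0; elim: n f => [//|n IHn] f f0 /=.
apply: le_trans (integral_ge_scale _ _) _ => //.
  by move=> t; exact: Rn_integral_ge0.
apply: integral_le => t; last exact: IHn.
by rewrite mule_ge0 ?lee_fin//; exact: Rn_integral_ge0.
Qed.

Lemma Rn_integral_le_off (n : nat) (f g : 'rV[R]_n.+1 -> \bar R) (a : R) :
  (forall x, 0 <= f x) -> (forall x, 0 <= g x) ->
  (forall x : 'rV[R]_n.+1, x ord0 ord0 != a -> f x <= g x) ->
  Rn_integral f <= Rn_integral g.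
Proof.
move=> f0 g0 fg /=; apply: (@integral_le_off _ _ _ a).
- by move=> t; exact: Rn_integral_ge0.
- by move=> t; exact: Rn_integral_ge0.
- by move=> t ta; apply: Rn_integral_le => // w; apply: fg; rewrite row_cons0.
Qed.

(** The weight depends on the first coordinate alone, so it is constant in the inner integral and
    scales out of it. *)
Lemma Rn_integral_gt0_weight (n : nat) (f g : 'rV[R]_n.+1 -> \bar R)
    (w : R -> R) (a : R) :
  (forall x, 0 <= f x) -> (forall x, 0 <= g x) ->
  (forall t, (0 < w t)%R) -> measurable_fun setT w ->
  (forall x : 'rV[R]_n.+1, x ord0 ord0 != a -> (w (x ord0 ord0))%:E * f x <= g x) ->
  0 < Rn_integral f -> 0 < Rn_integral g.
Proof.
move=> f0 g0 w0 mw fg /=; apply: (@integral_gt0_weight _ _ _ w a) => //.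
- by move=> t; exact: Rn_integral_ge0.
- by move=> t; exact: Rn_integral_ge0.
- move=> t ta; apply: le_trans (Rn_integral_ge_scale _ _) _ => //.
    exact: ltW.
  apply: Rn_integral_le => x.
    by rewrite mule_ge0// lee_fin ltW.
  by rewrite -[X in w X](row_cons0 t x) fg// row_cons0.
Qed.

(** The induction absorbs the factor in the first variable into [k]; as that factor may be infinite,
    [k] is an extended real. *)
Lemma Rn_integral_prod (n : nat) (k : \bar R) (g : 'I_n -> R -> \bar R) :
  0 <= k -> (forall i t, 0 <= g i t) -> (forall i, measurable_fun setT (g i)) ->
  Rn_integral (fun x => k * \prod_(i < n) g i (x ord0 i)) =
  k * \prod_(i < n) \int[mu]_t g i t.
Proof.
elim: n k g => [|n IHn] k g k0 g0 mg /=; first by rewrite !big_ord0.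
rewrite big_ord_recl.
have I0 : 0 <= \prod_(i < n) \int[mu]_t g (lift ord0 i) t.
  by elim/big_rec: _ => // i x _ x0; rewrite mule_ge0// integral_ge0.
transitivity (\int[mu]_t (k * \prod_(i < n) \int[mu]_s g (lift ord0 i) s * g ord0 t)).
  apply: eq_integral => t _.
  rewrite muleAC -IHn//; last by rewrite mule_ge0.
  congr Rn_integral; apply/funext => w.
  rewrite big_ord_recl row_cons0 muleA; congr (_ * _).
  by apply: eq_bigr => i _; rewrite row_consS.
rewrite ge0_integralZl ?mule_ge0//; last exact: mg.
by rewrite -muleA [X in _ * X]muleC.
Qed.

End IteratedIntegral.

(** * A one-dimensional integrable profile *)

Section Profile.
Context {R : realType}.
Local Notation mu := (@lebesgue_measure R).

Lemma powRN_le (a x y : R) : 0 <= a -> 0 < x -> x <= y ->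
  y `^ (- a) <= x `^ (- a).
Proof.
move=> a0 x0 xy; have y0 := lt_le_trans x0 xy.
rewrite !powRN lef_pV2 ?posrE ?powR_gt0//.
by apply: ge0_ler_powR; rewrite ?nnegrE // ltW.
Qed.

Lemma powR_exprn (a x : R) (k : nat) : 0 <= x -> (x ^+ k) `^ a = (x `^ a) ^+ k.
Proof. by move=> x0; rewrite -!powR_mulrn ?powR_ge0// powRAC. Qed.

Lemma powR_lt1 (a x : R) : 1 < x -> a < 0 -> x `^ a < 1.
Proof.
move=> x1 a0; have x0 : 0 < x by exact: lt_trans x1.
rewrite -(powRr0 x) /powR gt_eqF// ltr_expR mul0r nmulr_rlt0//.
exact: ln_gt0.
Qed.

Lemma dyadic_between (x : R) : 1 <= x ->
  exists k, 2 ^+ k <= x /\ x <= 2 ^+ k.+1.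
Proof.
move=> x1.
have ex : exists k, x <= 2 ^+ k.
  by exists (Num.bound x); apply: ltW; exact: upper_nthrootP.
case: (ex_minnP ex) => -[|k] xk kmin.
  exists 0%N; rewrite !expr0 in xk *; split=> //.
  by apply: le_trans xk _; rewrite expr1 ler1n.
exists k; split=> //; rewrite leNgt; apply/negP => /ltW /kmin.
by rewrite ltnn.
Qed.

(* The value at 0 is [+oo] because a product of profiles has to dominate
   [|x - y|^-(n - alpha)] also where only some of the coordinates of x and y
   coincide. *)
Definition profile (c m r : R) : \bar R :=
  if r == 0 then +oo%E
  else if `|r| <= 1 then (`|r| `^ (- c))%:E else (`|r| `^ (- m))%:E.

Lemma profile_gt0 (c m r : R) : (0 < profile c m r)%E.
Proof.
rewrite /profile; have [//|r0] := eqVneq r 0.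
by case: ifP => _; rewrite lte_fin powR_gt0 ?normr_gt0.
Qed.

Lemma profile_ge0 (c m r : R) : (0 <= profile c m r)%E.
Proof. exact/ltW/profile_gt0. Qed.

Lemma profile_ge_decay (c m s : R) : 0 <= c -> 0 <= m ->
  (((1 + `|s|) `^ (- m))%:E <= profile c m s)%E.
Proof.
move=> c0 m0; rewrite /profile; case: eqVneq => [_|s0]; first by rewrite leey.
have s0' : 0 < `|s| by rewrite normr_gt0.
have e1 (e : R) : 1 = 1 `^ e by rewrite powR1.
case: ifP => s1; rewrite lee_fin; last by apply: powRN_le => //; lra.
apply: (@le_trans _ _ 1).
  by rewrite [leRHS](e1 (- m)); apply: powRN_le => //; lra.
by rewrite [leLHS](e1 (- c)); apply: powRN_le.
Qed.

Lemma measurable_profile (c m : R) (t : R) :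
  measurable_fun setT (fun s : R => profile c m (t - s)).
Proof.
have mB : measurable_fun [set: R] (fun s : R => t - s).
  by apply: measurable_funB => //; exact: measurable_id.
have mN : measurable_fun [set: R] (fun s : R => `|t - s|).
  by apply: measurableT_comp.
have mP (e : R) : measurable_fun [set: R] (fun s : R => (`|t - s| `^ e)%:E).
  apply/measurable_EFinP.
  exact: (measurableT_comp (measurable_powR e) mN).
apply: measurable_fun_ifT; [exact: measurable_fun_eqr| exact: measurable_cst|].
by apply: measurable_fun_ifT => //; exact: measurable_fun_ler.
Qed.

Lemma geometric_nneseries (a z : R) : 0 <= a -> 0 <= z -> z < 1 ->
  (\sum_(0 <= k <oo) (a * z ^+ k)%:E)%E = (a / (1 - z))%:E.
Proof.
move=> a0 z0 z1; apply/cvg_lim => //.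
rewrite (_ : (fun n => _) = EFin \o series (geometric a z)).
  apply: cvg_EFin; first exact: nearW.
  by apply: cvg_geometric_series; rewrite ger0_norm.
by apply/funext => n /=; rewrite -sumEFin.
Qed.

Lemma integral_interval_series (t : R) (a rho : nat -> R) :
  (forall k, 0 <= a k) -> (forall k, 0 < rho k) ->
  (\int[mu]_s (\sum_(0 <= k <oo) (a k * \1_(`[t - rho k, t + rho k]) s)%:E) =
   \sum_(0 <= k <oo) (a k * (2 * rho k))%:E)%E.
Proof.
move=> a0 rho0; rewrite integral_nneseries//; last 2 first.
- move=> k; apply/measurable_EFinP; exact: measurable_funM.
- by move=> k s _; rewrite lee_fin mulr_ge0.
apply: eq_eseriesr => k _.
under eq_integral do rewrite EFinM.
rewrite ge0_integralZl_EFin//; last first.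
  by apply/measurable_EFinP; exact: measurable_indic.
rewrite integral_indic// setIT.
have tr : (t - rho k < t + rho k) by have := rho0 k; lra.
rewrite [X in (_ * X)%E](lebesgue_measure_itv `[t - rho k, t + rho k]) /= lte_fin tr.
by rewrite -EFinB -EFinM; congr ((_ * _)%:E); lra.
Qed.

(* Dyadic layers around t: rings of radius 2^-k inside, 2^(k+1) outside. *)
Lemma integral_profile (c m : R) : 0 < c -> c < 1 -> 1 < m ->
  exists K : R, 0 < K /\
    forall t, (\int[mu]_s profile c m (t - s) <= K%:E)%E.
Proof.
move=> c0 c1 m1.
(* Ratios of the geometric series over the inner and outer layers, below 1 because [c < 1] and
   [1 < m]. *)
pose zc : R := 2 `^ (c - 1); pose zm : R := 2 `^ (1 - m).
have two1 : 1 < 2 :> R by lra.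
have zc0 : 0 <= zc by exact: powR_ge0.
have zm0 : 0 <= zm by exact: powR_ge0.
have zc1 : zc < 1 by apply: powR_lt1 => //; lra.
have zm1 : zm < 1 by apply: powR_lt1 => //; lra.
(* [a1 k] bounds the profile at distances from 2^-(k+1) to [r1 k], and [a2 k] at distances from 2^k
   to [r2 k]; both bounds are then placed on the full intervals around t. *)
pose a1 (k : nat) : R := (2 ^+ k.+1) `^ c; pose r1 (k : nat) : R := 2 ^- k.
pose a2 (k : nat) : R := (2 ^+ k) `^ (- m); pose r2 (k : nat) : R := 2 ^+ k.+1.
have a10 k : 0 <= a1 k by exact: powR_ge0.
have a20 k : 0 <= a2 k by exact: powR_ge0.
have r10 k : 0 < r1 k by rewrite invr_gt0 exprn_gt0.
have r20 k : 0 < r2 k by rewrite exprn_gt0.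
have c20 : 0 <= 2 * 2 `^ c :> R by rewrite mulr_ge0// powR_ge0.
have E1 k : a1 k * (2 * r1 k) = 2 * 2 `^ c * zc ^+ k.
  rewrite /a1 /r1 /zc powR_exprn// powRB; last by apply/implyP => _; lra.
  by rewrite exprMn powRr1// exprVn exprS; ring.
have E2 k : a2 k * (2 * r2 k) = 4 * zm ^+ k.
  rewrite /a2 /r2 /zm powR_exprn// powRD; last by apply/implyP => _; lra.
  by rewrite exprMn powRr1// exprS; ring.
pose S (t : R) (a r : nat -> R) (s : R) : \bar R :=
  (\sum_(0 <= k <oo) (a k * \1_(`[t - r k, t + r k]) s)%:E)%E.
have S0 t a r s : (forall k : nat, 0 <= a k) -> (0 <= S t a r s)%E.
  by move=> a0; apply: nneseries_ge0 => k _ _; rewrite lee_fin mulr_ge0.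
have Sge t a r s k : (forall k : nat, 0 <= a k) -> `|t - s| <= r k ->
    ((a k)%:E <= S t a r s)%E.
  move=> a0 tsr; apply: le_trans (nneseries_lim_ge k.+1 _); last first.
    by move=> j _ _; rewrite lee_fin mulr_ge0.
  rewrite big_nat_recr//=.
  have -> : \1_(`[t - r k, t + r k]) s = 1 :> R.
    by rewrite indicE mem_set//= in_itv/=; move: tsr; rewrite ler_norml; lra.
  rewrite mulr1 leeDr//; apply: sume_ge0 => j _.
  by rewrite lee_fin mulr_ge0.
have mS t a r : (forall k : nat, 0 <= a k) -> measurable_fun setT (S t a r).
  move=> a0; apply: ge0_emeasurable_sum => [k s _ _|k _].
    by rewrite lee_fin mulr_ge0.
  apply/measurable_EFinP; exact: measurable_funM.
pose K := 2 * 2 `^ c / (1 - zc) + 4 / (1 - zm).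
exists K; split.
  have c2_gt0 : 0 < 2 `^ c :> R by exact: powR_gt0.
  by rewrite /K; apply: addr_gt0; apply: divr_gt0; lra.
move=> t; apply: (@le_trans _ _ (\int[mu]_s (S t a1 r1 s + S t a2 r2 s))%E).
  apply: (@integral_le_off _ _ _ t) => [s|s|s st].
  - exact: profile_ge0.
  - by rewrite adde_ge0//; exact: S0.
  rewrite /profile subr_eq0 eq_sym (negPf st).
  have ts0 : 0 < `|t - s| by rewrite normr_gt0 subr_eq0 eq_sym.
  case: ifP => [ts1|/negbT]; last rewrite -ltNge => ts1.
    have [|k [k1 k2]] := @dyadic_between (`|t - s|^-1); first by rewrite invf_ge1.
    apply: le_trans (leeDl _ (S0 _ _ _ _ a20)).
    apply: le_trans (Sge t a1 r1 s k a10 _); last first.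
      by rewrite /r1 -[leLHS]invrK lef_pV2 ?posrE ?invr_gt0 ?exprn_gt0.
    rewrite lee_fin -[`|t - s|]invrK -powR_inv1 ?invr_ge0// -powRrM mulrNN mul1r.
    by apply: ge0_ler_powR; rewrite ?nnegrE ?invr_ge0 ?exprn_ge0 ?(ltW c0).
  have [|k [k1 k2]] := @dyadic_between (`|t - s|); first exact: ltW.
  apply: le_trans (leeDr _ (S0 _ _ _ _ a10)).
  apply: le_trans (Sge t a2 r2 s k a20 _) => //.
  by rewrite lee_fin; apply: powRN_le; rewrite ?exprn_gt0//; lra.
rewrite ge0_integralD//; last 4 first.
- by move=> s _; exact: S0.
- exact: mS.
- by move=> s _; exact: S0.
- exact: mS.
rewrite !integral_interval_series//.
under eq_eseriesr do rewrite E1.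
under [X in (_ + X)%E]eq_eseriesr do rewrite E2.
by rewrite !geometric_nneseries.
Qed.

End Profile.

(** * Upper bounds by product weights *)

Section WeightedBounds.
Context {R : realType}.
Local Notation mu := (@lebesgue_measure R).

Lemma powRN_half_le (k y T : R) : 0 <= k -> 0 < T -> T <= 2 * y ->
  y `^ (- k) <= 2 `^ k * T `^ (- k).
Proof.
move=> k0 T0 Ty; apply: (@le_trans _ _ ((T / 2) `^ (- k))).
  by apply: powRN_le => //; lra.
have -> : 2 `^ k = 2^-1 `^ (- k) :> R.
  by rewrite -powR_inv1// -powRrM mulrNN mul1r.
by rewrite mulrC powRM// ?invr_ge0// ltW.
Qed.

(** Read [A = |t - s|], [B = 1 + |s|] and [T = 1 + |t|]. As [T <= A + B], the larger of [A] and [B]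
    is at least [T / 2] and yields the factor [T^-k]; what remains of the two powers is bounded by
    the smaller one at exponent [c + tau - k]. For [A <= 1] the singular power of [A] is kept as it
    is. *)
Lemma kernel_split_real (c tau k A B T : R) :
  0 <= k -> k <= c -> k <= tau -> 0 < A -> 1 <= B -> 0 < T -> T <= A + B ->
  A `^ (- c) * B `^ (- tau) <=
  2 `^ k * T `^ (- k) *
    (if A <= 1 then A `^ (- c) else
     if A < B then A `^ (- (c + tau - k)) else B `^ (- (c + tau - k))).
Proof.
move=> k0 kc ktau A0 B1 T0 TAB.
have B0 : 0 < B by lra.
have pD (x a b : R) : 0 < x -> x `^ (a + b) = x `^ a * x `^ b.
  by move=> x0; apply: powRD; rewrite (gt_eqF x0) implybT.
case: ifPn => [A1|]; last rewrite -ltNge => A1.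
  rewrite [leLHS]mulrC ler_wpM2r ?powR_ge0//.
  apply: (@le_trans _ _ (B `^ (- k))); first by apply: ler_powR => //; lra.
  by apply: powRN_half_le => //; lra.
case: ifPn => [AB|]; last rewrite -leNgt => BA.
  have -> : - tau = - k + - (tau - k) by ring.
  have -> : - (c + tau - k) = - c + - (tau - k) by ring.
  rewrite (pD B)// (pD A)// mulrCA ler_pM ?mulr_ge0 ?powR_ge0//.
    by apply: powRN_half_le => //; lra.
  by rewrite ler_wpM2l ?powR_ge0//; apply: powRN_le => //; lra.
have -> : - c = - k + - (c - k) by ring.
have -> : - (c + tau - k) = - (c - k) + - tau by ring.
rewrite (pD A)// (pD B)// -mulrA ler_pM ?mulr_ge0 ?powR_ge0//.
  by apply: powRN_half_le => //; lra.
by rewrite ler_wpM2r ?powR_ge0//; apply: powRN_le => //; lra.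
Qed.

(** The alternatives of the previous estimate become profiles centred at [t] and at [0], whose
    integrals over [s] are bounded uniformly in [t] for suitable exponents. *)
Lemma kernel_split (c tau k t s : R) :
  0 <= k -> k <= c -> k <= tau -> s != t ->
  ((`|t - s| `^ (- c) * (1 + `|s|) `^ (- tau))%:E <=
   (2 `^ k * (1 + `|t|) `^ (- k))%:E *
   (profile c (c + tau - k) (t - s) + profile c (c + tau - k) (0 - s)))%E.
Proof.
move=> k0 kc ktau st.
have A0 : 0 < `|t - s| by rewrite normr_gt0 subr_eq0 eq_sym.
have s0 := normr_ge0 s; have t0 := normr_ge0 t.
have B1 : 1 <= 1 + `|s| by lra.
have T0 : 0 < 1 + `|t| by lra.
have TAB : 1 + `|t| <= `|t - s| + (1 + `|s|).
  by have := ler_normD (t - s) s; rewrite subrK; lra.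
have := kernel_split_real k0 kc ktau A0 B1 T0 TAB.
rewrite -lee_fin EFinM [in X in (_ <= X)%E]EFinM => /le_trans; apply.
rewrite lee_wpmul2l ?lee_fin ?mulr_ge0 ?powR_ge0//.
case: ifPn => [A1|A1].
  apply: le_trans (leeDl _ (profile_ge0 _ _ _)).
  by rewrite /profile subr_eq0 eq_sym (negPf st) A1.
case: ifPn => AB.
  apply: le_trans (leeDl _ (profile_ge0 _ _ _)).
  by rewrite /profile subr_eq0 eq_sym (negPf st) (negPf A1).
apply: le_trans (leeDr _ (profile_ge0 _ _ _)).
have -> : `|s| = `|0 - s| by rewrite sub0r normrN.
by apply: profile_ge_decay; lra.
Qed.

Lemma enorm_ge0 (n : nat) (x : 'rV[R]_n) : 0 <= enorm x.
Proof. exact: sqrtr_ge0. Qed.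

Lemma coord_le_enorm (n : nat) (x : 'rV[R]_n) (i : 'I_n) :
  `|x ord0 i| <= enorm x.
Proof.
rewrite -sqrtr_sqr /enorm ler_sqrt.
  by rewrite (bigD1 i)//= lerDl sumr_ge0// => j _; exact: sqr_ge0.
by apply: sumr_ge0 => j _; exact: sqr_ge0.
Qed.

(** For [k >= 0], a majorant of the radial weight [(1 + |x|)^(- n k)] in which the variables
    separate. *)
Definition prod_weight (n : nat) (k : R) (x : 'rV[R]_n) : R :=
  \prod_(i < n) (1 + `|x ord0 i|) `^ (- k).

Lemma prod_weight_gt0 (n : nat) (k : R) (x : 'rV[R]_n) : 0 < prod_weight k x.
Proof.
apply: prodr_gt0 => i _; apply: powR_gt0.
by have := normr_ge0 (x ord0 i); lra.
Qed.

Lemma powR_prod (n : nat) (F : 'I_n -> R) (r : R) : (forall i, 0 <= F i) ->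
  (\prod_(i < n) F i) `^ r = \prod_(i < n) F i `^ r.
Proof.
move=> F0; suff [] : 0 <= \prod_(i < n) F i /\
    (\prod_(i < n) F i) `^ r = \prod_(i < n) F i `^ r by [].
elim/big_rec2 : _ => [|i y x _ [x0 <-]]; first by rewrite powR1 ler01.
by rewrite mulr_ge0// powRM.
Qed.

Lemma prod_weight_powR (n : nat) (k r : R) (x : 'rV[R]_n) :
  prod_weight k x `^ r = prod_weight (k * r) x.
Proof.
rewrite /prod_weight powR_prod => [|i]; last exact: powR_ge0.
by apply: eq_bigr => i _; rewrite -powRrM mulNr.
Qed.

Lemma decay_le_prod_weight (n : nat) (theta : R) (x : 'rV[R]_n) :
  (0 < n)%N -> 0 <= theta ->
  (1 + enorm x) `^ (- theta) <= prod_weight (theta / n%:R) x.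
Proof.
move=> n0 theta0; have n0' : 0 < n%:R :> R by rewrite ltr0n.
have E0 : 0 < 1 + enorm x by have := enorm_ge0 x; lra.
have -> : (1 + enorm x) `^ (- theta) =
    \prod_(i < n) (1 + enorm x) `^ (- (theta / n%:R)).
  rewrite prodr_const card_ord -powR_mulrn ?powR_ge0// -powRrM.
  by rewrite mulNr divfK// gt_eqF.
apply: ler_prod => i _; rewrite powR_ge0/=; apply: powRN_le.
- by rewrite divr_ge0// ltW.
- by have := normr_ge0 (x ord0 i); lra.
- by rewrite lerD2l coord_le_enorm.
Qed.

Lemma lee_prod (n : nat) (F G : 'I_n -> \bar R) :
  (forall i, (0 <= F i)%E) -> (forall i, (F i <= G i)%E) ->
  (\prod_(i < n) F i <= \prod_(i < n) G i)%E.
Proof.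
move=> F0 FG; suff /andP[] : (0 <= \prod_(i < n) F i <= \prod_(i < n) G i)%E by [].
elim/big_rec2 : _ => [|i x y _ /andP[y0 yx]]; first by rewrite lee01 lexx.
by rewrite mule_ge0//= lee_pmul.
Qed.

Lemma prod_EFin (n : nat) (F : 'I_n -> R) :
  (\prod_(i < n) (F i)%:E)%E = (\prod_(i < n) F i)%:E.
Proof. by apply/esym; elim/big_rec2 : _ => // i x y _ <-; rewrite EFinM. Qed.

Lemma prod_eqy (n : nat) (F : 'I_n -> \bar R) (i : 'I_n) :
  (forall i, (0 < F i)%E) -> F i = +oo%E -> (\prod_(j < n) F j)%E = +oo%E.
Proof.
move=> F0 Fi; rewrite (bigD1 i)//= Fi gt0_mulye//.
by elim/big_rec : _ => // j x _ x0; rewrite mule_gt0.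
Qed.

Lemma Rn_integral_powR_lty (n : nat) (f : 'rV[R]_n -> R) (C k r : R) :
  0 < C -> 1 < k * r -> 0 <= r -> (forall x, 0 <= f x) ->
  (forall x, f x <= C * prod_weight k x) ->
  (Rn_integral (fun x => (`|f x| `^ r)%:E) < +oo)%E.
Proof.
move=> C0 kr r0 f0 fC.
(* The inner exponent 1/2 is an arbitrary choice between 0 and 1; the decay of [f] enters through
   the outer exponent [k * r > 1]. *)
pose P (_ : 'I_n) (s : R) := profile 2^-1 (k * r) (0 - s).
have [K [K0 HK]] := @integral_profile R 2^-1 (k * r) ltac:(lra) ltac:(lra) kr.
apply: (@le_lt_trans _ _ ((C `^ r)%:E * \prod_(i < n) K%:E)%E); last first.
  by rewrite prod_EFin -EFinM ltry.
apply: (@le_trans _ _ (Rn_integral (fun x : 'rV[R]_n => (C `^ r)%:E *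
    \prod_(i < n) P i (x ord0 i))%E)).
  apply: Rn_integral_le => x; first by rewrite lee_fin powR_ge0.
  rewrite ger0_norm//.
  apply: (@le_trans _ _ ((C * prod_weight k x) `^ r)%:E).
    rewrite lee_fin; apply: ge0_ler_powR; rewrite ?nnegrE//.
    by rewrite mulr_ge0// ltW// prod_weight_gt0.
  rewrite powRM; [|exact: ltW|exact/ltW/prod_weight_gt0].
  rewrite prod_weight_powR EFinM lee_wpmul2l ?lee_fin ?powR_ge0//.
  rewrite -prod_EFin; apply: lee_prod => i; first by rewrite lee_fin powR_ge0.
  have -> : `|x ord0 i| = `|0 - x ord0 i| by rewrite sub0r normrN.
  by apply: profile_ge_decay; lra.
rewrite Rn_integral_prod; last 3 first.
- by rewrite lee_fin powR_ge0.
- by move=> i t; exact: profile_ge0.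
- by move=> i; exact: measurable_profile.
rewrite lee_wpmul2l ?lee_fin ?powR_ge0//; apply: lee_prod => i; last exact: HK.
by apply: integral_ge0 => s _; exact: profile_ge0.
Qed.

(** With [c = 1 - alpha / n], and when no coordinates coincide, the kernel is at most the product of
    the [|x_i - y_i|^-c], because [|x_i - y_i| <= |x - y|]. The splitting then applies in each
    coordinate: [tau <= 1] gives [k <= c], and [k < tau - alpha / n] says exactly that the outer
    exponent [c + tau - k] exceeds 1. *)
Lemma riesz_pot_le_prod_weight (n : nat) (alpha tau k C : R) (g : 'rV[R]_n -> R) :
  (0 < n)%N -> 0 < alpha -> alpha < n%:R -> tau <= 1 ->
  0 <= k -> k < tau - alpha / n%:R -> 0 < C ->
  (forall x, 0 <= g x) -> (forall x, g x <= C * prod_weight tau x) ->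
  exists C', 0 < C' /\
    forall x, (riesz_pot alpha g x <= (C' * prod_weight k x)%:E)%E.
Proof.
move=> n0 al0 aln tau1 k0 ktau C0 g0 gC.
have n0' : 0 < n%:R :> R by rewrite ltr0n.
pose c : R := 1 - alpha / n%:R.
have b0 : 0 < alpha / n%:R by rewrite divr_gt0.
have b1 : alpha / n%:R < 1 by rewrite ltr_pdivrMr// mul1r.
have [] := @integral_profile R c (c + tau - k); rewrite /c; [lra..|].
rewrite -/c => K [K0 HK].
pose G (x : 'rV[R]_n) (i : 'I_n) (s : R) : \bar R :=
  ((2 `^ k * (1 + `|x ord0 i|) `^ (- k))%:E *
   (profile c (c + tau - k) (x ord0 i - s) + profile c (c + tau - k) (0 - s)))%E.
have coef0 (x : 'rV[R]_n) i : 0 < 2 `^ k * (1 + `|x ord0 i|) `^ (- k).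
  by rewrite mulr_gt0// powR_gt0//; have := normr_ge0 (x ord0 i); lra.
have G0 x i s : (0 < G x i s)%E.
  rewrite /G mule_gt0 ?lte_fin//.
  by apply: lt_le_trans (leeDl _ (profile_ge0 _ _ _)); exact: profile_gt0.
have mG0 (t : R) : measurable_fun setT (fun s : R =>
    (profile c (c + tau - k) (t - s) + profile c (c + tau - k) (0 - s))%E).
  by apply: emeasurable_funD; exact: measurable_profile.
have mG x i : measurable_fun setT (G x i).
  by apply: measurable_funeM; exact: mG0.
have IG x i : (\int[mu]_s G x i s <=
    (2 `^ k * (1 + `|x ord0 i|) `^ (- k) * (K + K))%:E)%E.
  rewrite ge0_integralZl//; last 2 first.
  - exact: mG0.
  - by move=> s _; rewrite adde_ge0//; exact: profile_ge0.
  rewrite [leRHS]EFinM; apply: lee_wpmul2l; first by rewrite lee_fin ltW.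
  rewrite ge0_integralD//; last 4 first.
  - by move=> s _; exact: profile_ge0.
  - exact: measurable_profile.
  - by move=> s _; exact: profile_ge0.
  - exact: measurable_profile.
  by rewrite EFinD leeD.
exists (C * (2 `^ k * (K + K)) ^+ n); split.
  by rewrite mulr_gt0// exprn_gt0// mulr_gt0 ?powR_gt0//; lra.
move=> x; rewrite /riesz_pot.
apply: (@le_trans _ _ (Rn_integral (fun y : 'rV[R]_n =>
    C%:E * \prod_(i < n) G x i (y ord0 i))%E)).
  apply: Rn_integral_le => y.
    by rewrite lee_fin divr_ge0// powR_ge0.
  (* A shared coordinate makes one factor [+oo]; all factors are positive, so the product is [+oo]
     and the bound is trivial. *)
  have [[i xi]|xy] := pselect (exists i, x ord0 i = y ord0 i).
    rewrite (@prod_eqy _ _ i); first by rewrite gt0_muley ?lte_fin// leey.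
      by move=> j; exact: G0.
    rewrite /G xi subrr {1}/profile eqxx addye; last first.
      by rewrite gt_eqF// (lt_le_trans _ (profile_ge0 _ _ _)).
    by rewrite gt0_muley// lte_fin -xi.
  have xy' i : y ord0 i != x ord0 i.
    by apply/eqP => yx; apply: xy; exists i.
  apply: (@le_trans _ _ (C%:E * \prod_(i < n) (`|x ord0 i - y ord0 i| `^ (- c) *
      (1 + `|y ord0 i|) `^ (- tau))%:E)%E); last first.
    apply: lee_wpmul2l; first by rewrite lee_fin ltW.
    apply: lee_prod => i; first by rewrite lee_fin mulr_ge0 ?powR_ge0.
    by apply: kernel_split => //; rewrite /c; lra.
  rewrite prod_EFin -EFinM lee_fin big_split /= [X in C * X]mulrC mulrA.
  apply: ler_pM => //; first by rewrite invr_ge0 powR_ge0.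
  have c0 : 0 <= c by rewrite /c; lra.
  have -> : (enorm (x - y) `^ (n%:R - alpha))^-1 =
      \prod_(i < n) enorm (x - y) `^ (- c).
    rewrite prodr_const card_ord -powR_mulrn ?powR_ge0// -powRrM -powRN.
    by congr (_ `^ _); rewrite /c mulNr mulrBl mul1r divfK// gt_eqF.
  apply: ler_prod => i _; rewrite powR_ge0/=; apply: powRN_le => //.
    by rewrite normr_gt0 subr_eq0 eq_sym.
  by have := coord_le_enorm (x - y) i; rewrite !mxE.
rewrite Rn_integral_prod//; last 2 first.
- by rewrite lee_fin ltW.
- by move=> i t; exact: ltW.
apply: (@le_trans _ _ (C%:E * \prod_(i < n)
    (2 `^ k * (1 + `|x ord0 i|) `^ (- k) * (K + K))%:E)%E).
  apply: lee_wpmul2l; first by rewrite lee_fin ltW.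
  by apply: lee_prod => i //; apply: integral_ge0 => s _; exact: ltW.
rewrite prod_EFin -EFinM lee_fin -mulrA ler_wpM2l; [by []|exact: ltW|].
under eq_bigr do rewrite mulrAC.
by rewrite big_split /= prodr_const card_ord.
Qed.

End WeightedBounds.

(** * Lower bounds for Riesz potentials *)

Section PotentialLowerBounds.
Context {R : realType}.
Local Notation mu := (@lebesgue_measure R).

Lemma enorm_le_max (n : nat) (x : 'rV[R]_n) (M : R) :
  0 <= M -> (forall i, `|x ord0 i| <= M) -> enorm x <= n%:R * M.
Proof.
move=> M0 xM; have nM0 : 0 <= n%:R * M by rewrite mulr_ge0.
rewrite -[leRHS](ger0_norm nM0) -sqrtr_sqr; apply: ler_wsqrtr.
apply: (@le_trans _ _ (\sum_(i < n) M ^+ 2)).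
  by apply: ler_sum => i _; rewrite -real_normK ?num_real// lerXn2r ?nnegrE.
rewrite sumr_const card_ord exprMn -[leLHS]mulr_natl ler_wpM2r ?sqr_ge0//.
by rewrite -natrX ler_nat; case: n {x xM nM0} => // n; rewrite leq_pmulr.
Qed.

Lemma enorm_unbounded (n : nat) (L : R) :
  (0 < n)%N -> exists x : 'rV[R]_n, L <= enorm x.
Proof.
case: n => // n _; exists (const_mx `|L|).
apply: le_trans (coord_le_enorm _ ord0).
by rewrite mxE normr_id ler_norm.
Qed.

(** [a] may have either sign: [z >= 1] allows replacing it by [|a|], after which the power decreases
    in the base. *)
Lemma powR_bounded_ge (a z L : R) : 1 <= z -> z <= L ->
  L `^ (- `|a|) <= z `^ (- a).
Proof.
move=> z1 zL; apply: (@le_trans _ _ (z `^ (- `|a|))).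
  by apply: powRN_le => //; lra.
by apply: ler_powR => //; rewrite lerN2 ler_norm.
Qed.

Lemma powR_unbounded (e C M : R) : 0 < e -> 0 < C ->
  exists L : R, forall r, L <= r -> M < C * (1 + r) `^ e.
Proof.
move=> e0 C0; pose B := `|M| / C + 1.
have B0 : 0 < B by rewrite /B ltr_wpDl// divr_ge0// ltW.
exists (B `^ e^-1) => r Br.
have L0 : 0 <= B `^ e^-1 by exact: powR_ge0.
rewrite mulrC -ltr_pdivrMr//; apply: (@lt_le_trans _ _ B).
  rewrite /B; apply: (@le_lt_trans _ _ (`|M| / C)); last by rewrite ltrDl.
  by rewrite ler_pM2r ?invr_gt0// ler_norm.
have -> : B = (B `^ e^-1) `^ e.
  by rewrite -powRrM mulVf ?gt_eqF// powRr1// ltW.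
by apply: ge0_ler_powR; rewrite ?nnegrE//; lra.
Qed.

(* The first coordinate alone controls the passage from the singular kernel
   at the origin to the regularised one: |t| <= |y| bounds (1 + |y|) / |y|. *)
Lemma riesz_pot_ge_tail (n : nat) (alpha : R) (g : 'rV[R]_n -> R) :
  (0 < n)%N -> alpha < n%:R -> (forall x, 0 <= g x) ->
  (0 < riesz_pot alpha g 0)%E ->
  exists c, 0 < c /\ forall x,
    ((c * (1 + enorm x) `^ (- (n%:R - alpha)))%:E <= riesz_pot alpha g x)%E.
Proof.
case: n g => // n g _ aln g0 pot0.
set gam := n.+1%:R - alpha in pot0 *.
have gam0 : 0 < gam by rewrite subr_gt0.
have E1 (y : 'rV[R]_n.+1) : 0 < 1 + enorm y by have := enorm_ge0 y; lra.
pose F (y : 'rV[R]_n.+1) := (g y * (1 + enorm y) `^ (- gam))%:E.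
have F0 y : (0 <= F y)%E by rewrite lee_fin mulr_ge0// powR_ge0.
have pos_coord (y : 'rV[R]_n.+1) (t : R) :
    y ord0 ord0 != t -> 0 < `|t - y ord0 ord0|.
  by rewrite normr_gt0 subr_eq0 eq_sym.
have IF : (0 < Rn_integral F)%E.
  pose w (t : R) := (1 + `|t| `^ (-1)) `^ (- gam).
  have w1 t : 0 < 1 + `|t| `^ (-1) by have := powR_ge0 `|t| (-1); lra.
  apply: (@Rn_integral_gt0_weight _ _ _ _ w 0 _ F0 _ _ _ pot0).
  - by move=> y; rewrite lee_fin divr_ge0// powR_ge0.
  - by move=> t; rewrite powR_gt0.
  - have m1 : measurable_fun [set: R] (fun t : R => `|t| `^ (-1)).
      apply: (measurableT_comp (measurable_powR (-1))).
      exact: normr_measurable.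
    apply: (measurableT_comp (measurable_powR (- gam))).
    exact: measurable_funD.
  - move=> y y0; rewrite /F -EFinM lee_fin mulrCA ler_wpM2l//.
    have := pos_coord _ _ y0; rewrite sub0r normrN => y0'.
    have := coord_le_enorm y ord0 => yE.
    have yE0 : 0 < enorm y by lra.
    have -> : enorm (0 - y) = enorm y.
      by congr Num.sqrt; apply: eq_bigr => i _; rewrite !mxE sub0r sqrrN.
    rewrite ler_pdivrMr ?powR_gt0//.
    have -> : (1 + enorm y) `^ (- gam) * enorm y `^ gam =
        ((1 + enorm y) / enorm y) `^ (- gam).
      rewrite powRM ?invr_ge0 ?ltW//; congr (_ * _).
      by rewrite -powR_inv1 ?ltW// -powRrM mulrNN mul1r.
    apply: powRN_le; [exact: ltW|by rewrite divr_gt0|].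
    rewrite mulrDl mul1r divff ?gt_eqF// addrC lerD2l powR_inv1//.
    by rewrite lef_pV2 ?posrE.
(* The integral of [F] may be infinite at this point, so a positive real below it is taken. *)
have [I [I0 II]] : exists I : R, 0 < I /\ (I%:E <= Rn_integral F)%E.
  move: IF; case: (Rn_integral F) => [I|_|//]; last by exists 1; rewrite leey.
  by rewrite lte_fin => I0; exists I.
have n0 : 0 < n.+1%:R :> R by rewrite ltr0n.
(* The first factor comes from [|x - y| <= n.+1 (1 + |x|) (1 + |y|)], checked coordinatewise
   below. *)
exists (n.+1%:R `^ (- gam) * I); split; first by rewrite mulr_gt0// powR_gt0.
move=> x; pose k := (n.+1%:R * (1 + enorm x)) `^ (- gam).
have k0 : 0 <= k by exact: powR_ge0.
apply: (@le_trans _ _ (k%:E * Rn_integral F)%E).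
  rewrite mulrAC EFinM -powRM ?(ltW n0) ?(ltW (E1 x))// -/k.
  by apply: lee_wpmul2l => //; rewrite lee_fin.
apply: le_trans (Rn_integral_ge_scale k0 F0) _.
(* Dropping the hyperplane where [y] shares its first coordinate with [x] avoids the point [y = x],
   where the kernel has the value 0 by the conventions on powers and inverses of 0. *)
apply: (@Rn_integral_le_off _ _ _ _ (x ord0 ord0)).
- by move=> y; rewrite mule_ge0.
- by move=> y; rewrite lee_fin divr_ge0// powR_ge0.
move=> y yx; rewrite /F -EFinM lee_fin mulrCA ler_wpM2l// -powRN.
rewrite -powRM ?mulr_ge0 ?(ltW n0) ?(ltW (E1 _))//; apply: powRN_le; first exact: ltW.
  have := coord_le_enorm (x - y) ord0; rewrite !mxE; apply: lt_le_trans.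
  exact: pos_coord.
rewrite -mulrA; apply: enorm_le_max; first by rewrite mulr_ge0// ltW.
move=> i; rewrite !mxE; apply: le_trans (ler_normB _ _) _.
have := coord_le_enorm x i; have := coord_le_enorm y i.
have := mulr_ge0 (enorm_ge0 x) (enorm_ge0 y).
rewrite mulrDl !mulrDr !mul1r; lra.
Qed.

(** On the cube both [|y|] and [|x - y|] are comparable to [|x|], and the volume is [|x|^n]; so the
    integral is of order at least [|x|^(n - a - (n - alpha))]. *)
Lemma riesz_pot_ge_decay (n : nat) (alpha a C R0 : R) (g : 'rV[R]_n -> R) :
  (0 < n)%N -> 0 < alpha -> alpha < n%:R -> (forall x, 0 <= g x) -> 0 < C ->
  (forall x, R0 <= enorm x -> C * (1 + enorm x) `^ (- a) <= g x) ->
  exists C', 0 < C' /\ exists R1, forall x, R1 <= enorm x ->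
    ((C' * (1 + enorm x) `^ (- (a - alpha)))%:E <= riesz_pot alpha g x)%E.
Proof.
move=> n0 al0 aln g0 C0 gC.
set gam := n%:R - alpha.
have gam0 : 0 < gam by rewrite subr_gt0.
have n1 : 1 <= n%:R :> R by rewrite ler1n.
(* For [y] in the cube, [|x - y| <= L |x|] and [1 + |y| <= L (1 + |x|)]. *)
pose L : R := 4 * n%:R; have L4 : 4 <= L by rewrite /L; lra.
have L0 : 0 < L by lra.
(* The factors after [C] compare, in turn, [1 + |y|] with [1 + |x|], the kernel with
   [|x|^(-(n - alpha))], and [|x|^alpha] with [(1 + |x|)^alpha], the last one for [|x| >= 1]. *)
exists (C * L `^ (- `|a|) * L `^ (- gam) * 2 `^ (- alpha)); split.
  by rewrite !mulr_gt0// powR_gt0.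
exists (Num.max 1 R0) => x; rewrite ge_max => /andP[x1 xR].
set r := enorm x in x1 xR *.
have r0 : 0 < r by lra.
pose B : interval R := `[2 * r, 3 * r].
pose kap := C * (L `^ (- `|a|) * (1 + r) `^ (- a)) * (L * r) `^ (- gam).
have kap0 : 0 <= kap by rewrite /kap !mulr_ge0 ?powR_ge0// ltW.
pose P (_ : 'I_n) (s : R) : \bar R := (\1_[set` B] s)%:E.
apply: (@le_trans _ _ (Rn_integral (fun y : 'rV[R]_n =>
    kap%:E * \prod_(i < n) P i (y ord0 i))%E)).
  rewrite Rn_integral_prod; last 3 first.
  - by rewrite lee_fin.
  - by move=> i t; rewrite lee_fin.
  - by move=> i; apply/measurable_EFinP; exact: measurable_indic.
  have IB (i : 'I_n) : (\int[mu]_t P i t = r%:E)%E.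
    rewrite /P integral_indic// setIT [LHS](lebesgue_measure_itv B) /= lte_fin.
    by rewrite ifT -?EFinB; [congr EFin|]; lra.
  under eq_bigr do rewrite IB.
  rewrite prod_EFin -EFinM lee_fin prodr_const card_ord -powR_mulrn ?(ltW r0)//.
  have r10 : 0 < 1 + r by lra.
  have -> : - (a - alpha) = - a + alpha by ring.
  rewrite powRD; last by rewrite (gt_eqF r10) implybT.
  have -> : kap * r `^ n%:R =
      C * L `^ (- `|a|) * L `^ (- gam) * ((1 + r) `^ (- a) * r `^ alpha).
    rewrite /kap powRM ?(ltW r0) ?(ltW L0)//.
    have -> : r `^ alpha = r `^ (- gam) * r `^ n%:R.
      rewrite -powRD; first by congr (_ `^ _); rewrite /gam; ring.
      by rewrite (gt_eqF r0) implybT.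
    ring.
  rewrite -[leLHS]mulrA; apply: ler_wpM2l.
    by rewrite !mulr_ge0 ?powR_ge0// ltW.
  rewrite mulrCA; apply: ler_wpM2l; first exact: powR_ge0.
  rewrite powRN mulrC ler_pdivrMr ?powR_gt0// -powRM ?(ltW r0)//.
  by apply: ge0_ler_powR; rewrite ?nnegrE; lra.
apply: Rn_integral_le => y.
  rewrite mule_ge0 ?lee_fin// prod_EFin lee_fin.
  by apply: prodr_ge0 => i _.
have [yB|] := pselect (forall i, y ord0 i \in B); last first.
  move=> /existsNP[i /negP yi]; rewrite (bigD1 i)//= /P indicE memNset.
    by rewrite mul0e mule0 lee_fin divr_ge0// powR_ge0.
  by move=> /= yB; rewrite yB in yi.
rewrite big1 ?mule1; last first.
  by move=> i _; rewrite /P indicE mem_set//=; exact: yB.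
have yr i : 2 * r <= y ord0 i <= 3 * r by have := yB i; rewrite in_itv.
have xi i := coord_le_enorm x i.
pose i0 := Ordinal n0.
have ry : 2 * r <= enorm y.
  apply: le_trans (coord_le_enorm y i0); have /andP[yi _] := yr i0.
  by apply: le_trans yi (ler_norm _).
have yn : enorm y <= n%:R * (3 * r).
  apply: enorm_le_max => [|i]; first by lra.
  by have := yr i; rewrite ler_norml; lra.
have xyn : enorm (x - y) <= n%:R * (4 * r).
  apply: enorm_le_max => [|i]; first by lra.
  by have := yr i; have := xi i; rewrite !mxE !ler_norml -/r; lra.
have xy0 : 0 < enorm (x - y).
  apply: lt_le_trans (coord_le_enorm (x - y) i0); rewrite !mxE normr_gt0.
  by have := yr i0; have := xi i0; rewrite ler_norml -/r; lra.
rewrite lee_fin -powRN; apply: ler_pM; rewrite ?mulr_ge0 ?powR_ge0 ?(ltW C0)//.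
  apply: (le_trans _ (gC y _)); last by lra.
  apply: ler_wpM2l; first exact: ltW.
  have nr : 0 <= (n%:R - 1) * r by rewrite mulr_ge0//; lra.
  have r10 : 0 < 1 + r by lra.
  have -> : 1 + enorm y = (1 + enorm y) / (1 + r) * (1 + r).
    by rewrite divfK// gt_eqF.
  rewrite [leRHS]powRM; [|by rewrite divr_ge0; lra|exact: ltW].
  apply: ler_wpM2r; first exact: powR_ge0.
  apply: powR_bounded_ge.
    by rewrite ler_pdivlMr// mul1r; lra.
  by rewrite ler_pdivrMr// /L; nra.
apply: powRN_le => //; first exact: ltW.
by apply: le_trans xyn _; rewrite /L; lra.
Qed.

End PotentialLowerBounds.

(** * Solutions of the system *)

Section Solutions.
Context {R : realType}.

Lemma pos_bounded_solution_swap (n : nat) (alpha p q : R) (u v : 'rV[R]_n -> R) :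
  pos_bounded_solution alpha p q u v -> pos_bounded_solution alpha q p v u.
Proof.
move=> [mu [mv [u0 [v0 [[M uvM] [eu ev]]]]]]; do !split=> //.
by exists M => x; have [] := uvM x.
Qed.

(** [theta] may have either sign; a negative one means growth at infinity, which contradicts
    boundedness. *)
Definition slow_decay (n : nat) (theta : R) (f : 'rV[R]_n -> R) : Prop :=
  exists C : R, 0 < C /\ exists R0 : R, forall x, R0 <= enorm x ->
    C * (1 + enorm x) `^ (- theta) <= f x.

Lemma slow_decay_step (n : nat) (alpha p q theta : R) (u v : 'rV[R]_n -> R) :
  (0 < n)%N -> 0 < alpha -> alpha < n%:R -> 0 < p ->
  pos_bounded_solution alpha p q u v ->
  slow_decay theta u -> slow_decay (p * theta - alpha) v.
Proof.
move=> n0 al0 aln p0 [_ [_ [u0 [_ [_ [_ ev]]]]]] [C [C0 [R0 uC]]].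
have [||C' [C'0 [R1 vC']]] := @riesz_pot_ge_decay R n alpha (p * theta) (C `^ p) R0
    (fun y => u y `^ p) n0 al0 aln (fun=> powR_ge0 _ _).
- exact: powR_gt0.
- move=> x xR.
  have E0 : 0 <= (1 + enorm x) `^ (- theta) by exact: powR_ge0.
  have -> : (1 + enorm x) `^ (- (p * theta)) = ((1 + enorm x) `^ (- theta)) `^ p.
    by rewrite -powRrM mulNr mulrC.
  rewrite -powRM ?(ltW C0)//; apply: ge0_ler_powR.
  + exact: ltW.
  + by rewrite nnegrE mulr_ge0// ltW.
  + by rewrite nnegrE ltW.
  + exact: uC.
exists C'; split=> //; exists R1 => x xR.
by rewrite -lee_fin ev; exact: vC'.
Qed.

Lemma not_slow_decay (n : nat) (alpha p q theta : R) (u v : 'rV[R]_n -> R) :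
  (0 < n)%N -> 0 < alpha -> alpha < n%:R -> 0 < p -> 0 < q -> 1 < p * q ->
  pos_bounded_solution alpha p q u v ->
  theta < alpha * (q + 1) / (p * q - 1) -> ~ slow_decay theta u.
Proof.
move=> n0 al0 aln p0 q0 pq1 sol; set a := _ / _ => ta su.
have sol' := pos_bounded_solution_swap sol.
have aE : a * (p * q - 1) = alpha * (q + 1) by rewrite divfK// gt_eqF// subr_gt0.
(* Two steps send [theta] to [q * (p * theta - alpha) - alpha], an affine map of slope [p * q] whose
   fixed point is [a]. *)
have iter j : slow_decay (a - (p * q) ^+ j * (a - theta)) u.
  elim: j => [|j IHj]; first by rewrite expr0 mul1r subKr.
  have := slow_decay_step n0 al0 aln q0 sol' (slow_decay_step n0 al0 aln p0 sol IHj).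
  congr (slow_decay _ u); rewrite exprS; move: aE; set X := _ ^+ j; nra.
pose h := p * q - 1; have h0 : 0 < h by rewrite subr_gt0.
(* By Bernoulli's inequality for [p * q = 1 + h], any [j] above [|a| / (h (a - theta))] is large
   enough. *)
have [j aj] : exists j : nat, a < (p * q) ^+ j * (a - theta).
  pose j := Num.bound (`|a| / (h * (a - theta))); exists j.
  have d0 : 0 < a - theta by rewrite subr_gt0.
  have hd0 : 0 < h * (a - theta) by rewrite mulr_gt0.
  have bj : `|a| / (h * (a - theta)) < j%:R.
    by apply: archi_boundP; rewrite divr_ge0// ltW.
  have bern k : 1 + k%:R * h <= (p * q) ^+ k.
    have -> : p * q = 1 + h by rewrite /h; ring.
    elim: k => [|k IHk]; first by rewrite mul0r addr0 expr0.
    rewrite exprS -natr1.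
    have : 0 <= k%:R * h * h by rewrite !mulr_ge0// ltW.
    have : (1 + h) * (1 + k%:R * h) <= (1 + h) * (1 + h) ^+ k.
      by rewrite ler_pM2l//; lra.
    lra.
  move: bj; rewrite ltr_pdivrMr// => bj.
  have : (1 + j%:R * h) * (a - theta) <= (p * q) ^+ j * (a - theta).
    by rewrite ler_pM2r.
  have := ler_norm a; nra.
have [C [C0 [R0 uC]]] := iter j.
have [_ [_ [_ [_ [[M uvM] _]]]]] := sol.
set e := _ - _ in uC.
have e0 : 0 < - e by rewrite /e; lra.
have [L ML] := powR_unbounded M e0 C0.
have [x] := @enorm_unbounded R n (Num.max L R0) n0.
rewrite ge_max => /andP[/ML + /uC]; have [] := uvM x; lra.
Qed.

(** Where [|x| < R0], the product of [(1 + |R0|)^theta] and [(1 + |x|)^(-theta)] is at least 1 and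
    so absorbs the bound [|M|]; the sum of the two constants works everywhere. *)
Lemma bounded_decay_global (n : nat) (theta M C R0 : R) (f : 'rV[R]_n -> R) :
  0 <= theta -> 0 < C -> (forall x, f x <= M) ->
  (forall x, R0 <= enorm x -> f x <= C * (1 + enorm x) `^ (- theta)) ->
  exists C', 0 < C' /\ forall x, f x <= C' * (1 + enorm x) `^ (- theta).
Proof.
move=> th0 C0 fM fC.
have D0 : 0 <= `|M| * (1 + `|R0|) `^ theta by rewrite mulr_ge0// powR_ge0.
exists (C + `|M| * (1 + `|R0|) `^ theta); split; first lra.
move=> x; have E0 := enorm_ge0 x.
rewrite mulrDl; have [xR|xR] := leP R0 (enorm x).
  by apply: le_trans (fC x xR) _; rewrite lerDl mulr_ge0// powR_ge0.
apply: (@le_trans _ _ `|M|); first exact: le_trans (fM x) (ler_norm _).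
rewrite -mulrA; set X := (_ * (_ * _)).
suff : `|M| <= X by have := mulr_ge0 (ltW C0) (powR_ge0 (1 + enorm x) (- theta)); lra.
have P0 : 0 < (1 + enorm x) `^ theta by apply: powR_gt0; lra.
rewrite /X ler_peMr// powRN ler_pdivlMr// mul1r.
by apply: ge0_ler_powR; rewrite ?nnegrE//; have := ler_norm R0; lra.
Qed.

Lemma fast_decay_in_Lp (n : nat) (alpha p q theta C R0 : R) (u v : 'rV[R]_n -> R) :
  (0 < n)%N -> 0 < alpha -> alpha < n%:R -> 0 < p -> 0 < q -> 1 < p * q ->
  pos_bounded_solution alpha p q u v ->
  alpha * (q + 1) / (p * q - 1) < theta -> 0 < C ->
  (forall x, R0 <= enorm x -> u x <= C * (1 + enorm x) `^ (- theta)) ->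
  in_Lp (n%:R * (p * q - 1) / (alpha * (q + 1))) u /\
  in_Lp (n%:R * (p * q - 1) / (alpha * (p + 1))) v.
Proof.
move=> n0 al0 aln p0 q0 pq1 sol; set a := _ / (p * q - 1) => ath C0 uC.
have sol' := pos_bounded_solution_swap sol.
have [mu [mv [u0 [v0 [[M uvM] [_ ev]]]]]] := sol.
have N0 : 0 < n%:R :> R by rewrite ltr0n.
have h0 : 0 < p * q - 1 by rewrite subr_gt0.
have aq0 : 0 < alpha * (q + 1) by rewrite mulr_gt0//; lra.
have ap0 : 0 < alpha * (p + 1) by rewrite mulr_gt0//; lra.
pose b := alpha * (p + 1) / (p * q - 1).
have a0 : 0 < a by rewrite divr_gt0.
have b0 : 0 < b by rewrite divr_gt0.
have aE : a * (p * q - 1) = alpha * (q + 1) by rewrite divfK// gt_eqF.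
have bE : b * (p * q - 1) = alpha * (p + 1) by rewrite divfK// gt_eqF.
have hn0 : p * q - 1 != 0 by rewrite gt_eqF.
(* The two equations exchange the critical rates: decay at rate [a] for [u] corresponds to rate
   [p * a - alpha = b] for [v], and conversely. *)
have pab : p * a = b + alpha.
  by apply: (mulIf hn0); rewrite -mulrA aE mulrDl bE; ring.
have qba : q * b = a + alpha.
  by apply: (mulIf hn0); rewrite -mulrA bE mulrDl aE; ring.
(* The Lebesgue exponents are [n / a] and [n / b], so decay faster than the rates [a] and [b] is
   what gives integrability. *)
have r0E : n%:R * (p * q - 1) / (alpha * (q + 1)) = n%:R / a.
  by rewrite -aE; field; rewrite !gt_eqF.
have s0E : n%:R * (p * q - 1) / (alpha * (p + 1)) = n%:R / b.
  by rewrite -bE; field; rewrite !gt_eqF.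
rewrite r0E s0E.
(* Comparing the universal lower bound on v with the assumed decay of u
   excludes pa >= n, the critical case included. *)
have pan : p * a < n%:R.
  rewrite ltNge; apply/negP => npa.
  have tail : slow_decay (n%:R - alpha) v.
    have [||c [c0 vc]] := @riesz_pot_ge_tail R n alpha (fun y => u y `^ p) n0 aln.
    - by move=> x; exact: powR_ge0.
    - by rewrite -ev lte_fin.
    by exists c; split=> //; exists 0 => x _; rewrite -lee_fin ev.
  have [c [c0 [R1 uc]]] := slow_decay_step n0 al0 aln q0 sol' tail.
  (* Here [p * a >= n] reads [n - alpha <= b], so the new rate for [u] is at most
     [q * b - alpha = a], strictly below [theta]. *)
  have e0 : 0 < theta - (q * (n%:R - alpha) - alpha).
    have : q * (n%:R - alpha) <= q * b by apply: ler_wpM2l; lra.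
    lra.
  have [L HL] := powR_unbounded C e0 c0.
  have [x] := @enorm_unbounded R n (Num.max L (Num.max R0 R1)) n0.
  rewrite !ge_max => /and3P[/HL xL /uC xC /uc xc].
  have E0 : 0 < 1 + enorm x by have := enorm_ge0 x; lra.
  have T0 : 0 < (1 + enorm x) `^ (- theta) by exact: powR_gt0.
  have : C * (1 + enorm x) `^ (- theta) <
      c * (1 + enorm x) `^ (- (q * (n%:R - alpha) - alpha)).
    rewrite (_ : - (q * _ - _) = (theta - (q * (n%:R - alpha) - alpha)) + - theta).
      by rewrite powRD ?(gt_eqF E0) ?implybT// mulrA ltr_pM2r.
    by ring.
  by move=> /lt_le_trans /(_ (le_trans xc xC)); rewrite ltxx.
(* Capping at the midpoint of [a] and [n / p] keeps [th] above [a] and gives [p * th < n], hence the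
   condition [tau <= 1] below. *)
pose th := Num.min theta ((a + n%:R / p) / 2).
have an : a < n%:R / p by rewrite ltr_pdivlMr// mulrC.
have ath' : a < th by rewrite lt_min ath/=; lra.
have pth : p * th < n%:R.
  rewrite -ltr_pdivlMl// mulrC.
  have : th <= (a + n%:R / p) / 2 by rewrite ge_min lexx orbT.
  lra.
have th0 : 0 < th by lra.
have [C1 [C10 uC1]] : exists C', 0 < C' /\
    forall x, u x <= C' * (1 + enorm x) `^ (- th).
  apply: (@bounded_decay_global _ _ M C R0) => //; first exact: ltW.
    by move=> x; have [] := uvM x.
  move=> x /uC /le_trans; apply; apply: ler_wpM2l; first exact: ltW.
  apply: ler_powR; first by have := enorm_ge0 x; lra.
  by rewrite lerN2 ge_min lexx.
have uW x : u x <= C1 * prod_weight (th / n%:R) x.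
  apply: le_trans (uC1 x) _; apply: ler_wpM2l; first exact: ltW.
  by apply: decay_le_prod_weight => //; exact: ltW.
split; split=> //.
  apply: (@Rn_integral_powR_lty _ _ _ C1 (th / n%:R)) => //.
  - have -> : th / n%:R * (n%:R / a) = th / a by field; rewrite !gt_eqF.
    by rewrite ltr_pdivlMr// mul1r.
  - by rewrite divr_ge0// ltW.
  - by move=> x; exact: ltW.
(* [tau] is the weight exponent of [u^p]. The midpoint [k] lies strictly between [b / n] and
   [tau - alpha / n], an interval that is nonempty as [p * th > p * a = b + alpha]; then [k > b / n]
   makes [k * (n / b)] exceed 1. *)
pose tau := th / n%:R * p; pose k := ((tau - alpha / n%:R) + b / n%:R) / 2.
have bn0 : 0 < b / n%:R by rewrite divr_gt0.
have tb : b / n%:R < tau - alpha / n%:R.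
  rewrite /tau; have -> : th / n%:R * p = p * th / n%:R by ring.
  rewrite -mulrBl ltr_pM2r ?invr_gt0//.
  have : p * a < p * th by rewrite ltr_pM2l.
  lra.
have [| | | | | |C2 [C20 vC2]] := @riesz_pot_le_prod_weight R n alpha tau k (C1 `^ p)
    (fun y => u y `^ p) n0 al0 aln.
- rewrite /tau; have -> : th / n%:R * p = p * th / n%:R by ring.
  by rewrite ler_pdivrMr// mul1r ltW.
- by rewrite /k; lra.
- by rewrite /k; lra.
- exact: powR_gt0.
- by move=> x; exact: powR_ge0.
- move=> x; rewrite -prod_weight_powR -powRM; last 2 first.
  + exact: ltW.
  + exact/ltW/prod_weight_gt0.
  apply: ge0_ler_powR; [exact: ltW|by rewrite nnegrE ltW| |exact: uW].
  by rewrite nnegrE mulr_ge0 ?ltW// prod_weight_gt0.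
apply: (@Rn_integral_powR_lty _ _ _ C2 k) => //.
- rewrite mulrA ltr_pdivlMr// mul1r -ltr_pdivrMr//.
  by rewrite /k; lra.
- by rewrite divr_ge0// ltW.
- by move=> x; exact: ltW.
- by move=> x; rewrite -lee_fin ev.
Qed.

End Solutions.

Theorem theorem1p3 (R : realType) (n : nat) (alpha p q : R)
  (u v : 'rV[R]_n -> R) :
  (3 <= n)%N -> 0 < alpha -> alpha < n%:R -> 0 < p -> 0 < q -> 1 < p * q ->
  pos_bounded_solution alpha p q u v ->
  (* (1) *)
  (forall theta1 : R, theta1 < alpha * (q + 1) / (p * q - 1) ->
     ~ (exists C : R, 0 < C /\ exists R0 : R, forall x, R0 <= enorm x ->
          C * (1 + enorm x) `^ (- theta1) <= u x)) /\
  (forall theta2 : R, theta2 < alpha * (p + 1) / (p * q - 1) ->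
     ~ (exists C : R, 0 < C /\ exists R0 : R, forall x, R0 <= enorm x ->
          C * (1 + enorm x) `^ (- theta2) <= v x)) /\
  (* (2) *)
  (~ (in_Lp (n%:R * (p * q - 1) / (alpha * (q + 1))) u /\
      in_Lp (n%:R * (p * q - 1) / (alpha * (p + 1))) v) ->
   (forall theta3 : R, alpha * (q + 1) / (p * q - 1) < theta3 ->
     ~ (exists C : R, 0 < C /\ exists R0 : R, forall x, R0 <= enorm x ->
          u x <= C * (1 + enorm x) `^ (- theta3))) /\
   (forall theta4 : R, alpha * (p + 1) / (p * q - 1) < theta4 ->
     ~ (exists C : R, 0 < C /\ exists R0 : R, forall x, R0 <= enorm x ->
          v x <= C * (1 + enorm x) `^ (- theta4)))).
Proof.
move=> n3 al0 aln p0 q0 pq1 sol.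
have n0 : (0 < n)%N by apply: leq_trans n3.
have sol' := pos_bounded_solution_swap sol.
have qp1 : 1 < q * p by rewrite mulrC.
split; first by move=> th1 th1a; exact: (not_slow_decay n0 al0 aln p0 q0 pq1 sol th1a).
split.
  move=> th2; rewrite [p * q]mulrC => th2b.
  exact: (not_slow_decay n0 al0 aln q0 p0 qp1 sol' th2b).
move=> notLp; split.
  move=> th3 ath3 [C [C0 [R0 uC]]]; apply: notLp.
  exact: (fast_decay_in_Lp n0 al0 aln p0 q0 pq1 sol ath3 C0 uC).
move=> th4 + [C [C0 [R0 vC]]]; rewrite [p * q]mulrC => bth4; apply: notLp.
rewrite [p * q]mulrC.
(* The swapped system delivers the two memberships in the opposite order. *)
by have [] := fast_decay_in_Lp n0 al0 aln q0 p0 qp1 sol' bth4 C0 vC.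
Qed.
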